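(* Fix $s,t\in X_2$. Then the martingale $(M_n(s,t;\cdot))_{n\ge0}$ converges in $L^2(\Omega,\mu)$ and $\mu$-almost surely to a limit $M_\infty(s,t;\cdot)\in L^2(\Omega,\mu)$. Moreover, $$K_\infty(s,t)=\mathbb{E}[M_\infty(s,t;\cdot)].$$
   Context: Let $X$ be a set, $m\ge1$ an integer, and $\varphi_1,\dots,\varphi_m:X\to X$ maps. A kernel $J:Y\times Y\to\mathbb{C}$ is positive definite if $\sum_{\alpha,\beta}\overline{c_\alpha}c_\beta J(s_\alpha,s_\beta)\ge0$ for all finite families $(c_\alpha,s_\alpha)\in\mathbb{C}\times Y$; $J_1\le J_2$ means that $J_2-J_1$ is positive definite. The pullback operator is $(LJ)(s,t):=\sum_{i=1}^m J(\varphi_i(s),\varphi_i(t))$. Fix a positive definite kernel $K$ on $X$ with $LK\ge K$. Set $K_0:=K$, $K_{n+1}:=LK_n$, $u_n(s):=K_n(s,s)$ (nondecreasing in $n$), $u_\infty(s):=\lim_nu_n(s)\in[0,\infty]$, $X_{\mathrm{fin}}:=\{s\in X:u_\infty(s)<\infty\}$. Each $\varphi_i$ maps $X_{\mathrm{fin}}$ into itself. For $s,t\in X_{\mathrm{fin}}$ the limit $K_\infty(s,t):=\lim_nK_n(s,t)$ exists; $K_\infty$ is positive definite on $X_{\mathrm{fin}}$ and $LK_\infty=K_\infty$ there; $K_\infty(s,s)=u_\infty(s)$. Words: $W_n:=\{1,\dots,m\}^n$, $W_0=\{\emptyset\}$; for $w=i_1\cdots i_n\in W_n$, $\varphi_w:=\varphi_{i_n}\circ\cdots\circ\varphi_{i_1}$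 ($\varphi_\emptyset=\mathrm{id}$). $\Omega:=\{1,\dots,m\}^{\mathbb{N}}$ with product $\sigma$-algebra and product probability measure $\mu$ making the coordinates independent and uniform on $\{1,\dots,m\}$; $\mathbb{E}$ is expectation with respect to $\mu$. For $\omega=\omega_1\omega_2\cdots\in\Omega$, $\omega|n:=\omega_1\cdots\omega_n\in W_n$ ($\omega|0=\emptyset$). For $s,t\in X_{\mathrm{fin}}$, $M_n(s,t;\omega):=m^nK_\infty(\varphi_{\omega|n}(s),\varphi_{\omega|n}(t))$; this is a martingale for the filtration generated by the coordinates. For $s\in X_{\mathrm{fin}}$ let $B(s):=\sup_{n\ge0}\{m^n\sum_{w\in W_n}u_\infty(\varphi_w(s))^2\}\in[0,\infty]$, and $X_2:=\{s\in X_{\mathrm{fin}}:B(s)<\infty\}$. *)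

(* Defs.v *)
From HB Require Import structures.
From mathcomp Require Import all_boot all_order all_algebra finmap.
From mathcomp Require Import all_classical all_reals all_analysis.
From mathcomp Require Export complex.

Set Implicit Arguments.
Unset Strict Implicit.
Unset Printing Implicit Defensive.

Import Order.TTheory GRing.Theory Num.Theory.
Import numFieldNormedType.Exports.

Local Open Scope classical_set_scope.
Local Open Scope ring_scope.

(* The regular module R[i]^o is R[i] with its norm topology. *)

Definition ckernel (R : realType) (Y : Type) := Y -> Y -> R[i].

Section Kernels.
Context {R : realType} {X : Type}.

(* In R[i], 0 <= z means that z is real and nonnegative. *)
Definition positive_definite (Y : Type) (J : ckernel R Y) : Prop :=
  forall (k : nat) (c : 'I_k -> R[i]) (s : 'I_k -> Y),
    0 <= \sum_(a < k) \sum_(b < k) Num.conj (c a) * c b * J (s a) (s b).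

Definition kernel_le (Y : Type) (J1 J2 : ckernel R Y) : Prop :=
  positive_definite (fun s t => J2 s t - J1 s t).

Context {m : nat} (phi : 'I_m -> X -> X).

Definition pullback (J : ckernel R X) : ckernel R X :=
  fun s t => \sum_(i < m) J (phi i s) (phi i t).

(* The first letter of the word acts first:
   word_map [:: i_1; ...; i_n] = phi i_n \o ... \o phi i_1. *)
Definition word_map (w : seq 'I_m) (s : X) : X :=
  foldl (fun x i => phi i x) s w.

Variable K : ckernel R X.

Definition Kn (n : nat) : ckernel R X := iter n pullback K.

(* K_n(s, s) is real, so only its real part is kept. *)
Definition un (n : nat) (s : X) : R := complex.Re (Kn n s s).

Definition uinf (s : X) : \bar R := limn (fun n => (un n s)%:E).

Definition Xfin : set X := [set s | (uinf s < +oo)%E].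

Definition Kinf : ckernel R X :=
  fun s t => lim ((Kn n s t : R[i]^o) @[n --> \oo]).

Definition Bsup (s : X) : \bar R :=
  ereal_sup (range (fun n : nat =>
    (m%:R ^+ n)%:E * \sum_(w : n.-tuple 'I_m) uinf (word_map w s) ^+ 2)%E).

Definition X2 : set X := [set s | Xfin s /\ (Bsup s < +oo)%E].

End Kernels.

HB.instance Definition _ (p : nat) := isPointed.Build 'I_p.+1 ord0.

(* Library measurable types are pointed, so the alphabet is 'I_p.+1, i.e.
   m = p.+1; this encodes m >= 1. *)
Section SequenceSpace.
Context {R : realType} {p : nat}.

Definition coord_sets : set (set (nat -> 'I_p.+1)) :=
  \bigcup_(i in [set: nat])
    preimage_set_system setT (fun w : nat -> 'I_p.+1 => w i) setT.

Definition Omega := g_sigma_algebraType coord_sets.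

HB.instance Definition _ := Measurable.on Omega.

Definition word_upto (n : nat) (w : Omega) : n.-tuple 'I_p.+1 :=
  [tuple w i | i < n].

Definition coords_uniform (mu : probability Omega R) : Prop :=
  forall (i : nat) (a : 'I_p.+1), mu [set w | w i = a] = (p.+1%:R^-1)%:E.

Definition coords_independent (mu : probability Omega R) : Prop :=
  forall (J : {fset nat}) (A : nat -> set 'I_p.+1),
    mu (\bigcap_(i in [set` J]) [set w | A i (w i)]) =
    (\prod_(i <- J) mu [set w | A i (w i)])%E.

Definition uniform_product_measure (mu : probability Omega R) : Prop :=
  coords_uniform mu /\ coords_independent mu.

End SequenceSpace.
Arguments Omega : clear implicits.

Section ComplexRandomVariables.
Context {d : measure_display} {T : measurableType d} {R : realType}.
Variable P : probability T R.

Definition cmeasurable (f : T -> R[i]) : Prop :=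
  measurable_fun setT (fun x => complex.Re (f x)) /\
  measurable_fun setT (fun x => complex.Im (f x)).

Definition cL2 (f : T -> R[i]) : Prop :=
  cmeasurable f /\ finite_norm P 2%:E (fun x => ComplexField.Normc.normc (f x)).

Definition cvg_cL2 (f : nat -> T -> R[i]) (g : T -> R[i]) : Prop :=
  [/\ (forall n, cL2 (f n)), cL2 g &
      Lnorm P 2%:E (fun x => (ComplexField.Normc.normc (f n x - g x))%:E)
        @[n --> \oo] --> (0%R)%:E].

Definition cvg_ae (f : nat -> T -> R[i]) (g : T -> R[i]) : Prop :=
  {ae P, forall x, (f n x : R[i]^o) @[n --> \oo] --> (g x : R[i]^o)}.

Definition cexpectation (f : T -> R[i]) : R[i] :=
  Complex (fine ('E_P[fun x => complex.Re (f x)])%E)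
          (fine ('E_P[fun x => complex.Im (f x)])%E).

End ComplexRandomVariables.

Definition Mn {R : realType} {X : Type} {p : nat} (phi : 'I_p.+1 -> X -> X)
    (K : ckernel R X) (s t : X) (n : nat) (w : Omega p) : R[i] :=
  p.+1%:R ^+ n * Kinf phi K (word_map phi (word_upto n w) s)
                            (word_map phi (word_upto n w) t).

(* Main.v *)
Require Import Defs.
From mathcomp Require Import all_boot all_order all_algebra finmap.
From mathcomp Require Import all_classical all_reals all_analysis.
From mathcomp Require Import measurable_realfun.
From mathcomp Require Import ring lra.

(** Why the theorem holds.

    Two things make the sequence M_n behave. First, K_infty is invariant under
    the pullback, so M_n, seen as a function of the word of its first n letters,
    equals the mean of M_(n+1) over the next letter (word_weight_martingale).
    Second, positive definiteness bounds the real and imaginary parts of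
    K_infty(a, b) by the arithmetic mean of u_infty(a) and u_infty(b)
    (Kinf_entry_le); squaring and averaging over the words of length n, the
    second moment of either part of M_n(s, t) is at most the arithmetic mean of
    the two quantities whose suprema over n are B(s) and B(t) (word_weight_bound). So the real and imaginary
    parts of M_n are real martingales bounded in L^2, and
    word_martingale_L2_convergence applies to each.

    A martingale here is a function on finite words. All expectations and
    probabilities of events that depend on n letters are finite averages over
    the words of length n, because a cylinder of n letters has measure m^-n.
    Increments of a word martingale are orthogonal, so the second moments are
    nondecreasing and E|M_n - M_N|^2 is the difference of two of them
    (word_mean_sqr_incr); being bounded, they converge. The maximal inequality,
    proved by induction on the number of letters still to be drawn
    (doob_maximal), bounds the probability that M_k ever strays far from M_N,
    so almost every path is Cauchy (ae_cvg). Fatou's lemma turns the almost sure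
    limit into an L^2 limit (L2_word_limit), and since the means of M_n are all
    equal to M_0 = K_infty(s, t), so is the mean of the limit. *)

Set Implicit Arguments.
Unset Strict Implicit.
Unset Printing Implicit Defensive.
Import Order.TTheory GRing.Theory Num.Theory.
Import numFieldNormedType.Exports.
Local Open Scope classical_set_scope.
Local Open Scope ring_scope.

(** * Averages over words and the maximal inequality *)

Section WordAverages.
Context {R : realType} {p : nat}.
Local Notation A := 'I_p.+1.
Implicit Types (g h F : seq A -> R) (v w : seq A).

Definition word_mean (n : nat) g w : R :=
  p.+1%:R ^- n * \sum_(x : n.-tuple A) g (w ++ x).

Lemma word_mean0 g w : word_mean 0 g w = g w.
Proof.
rewrite /word_mean expr0 invr1 mul1r (big_pred1 [tuple]) ?cats0// => x.
by apply/esym/eqP; exact: tuple0.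
Qed.

Lemma word_meanS n g w :
  word_mean n.+1 g w = p.+1%:R^-1 * \sum_(a < p.+1) word_mean n g (rcons w a).
Proof.
rewrite /word_mean exprS invfM -mulrA; congr (_ * _); rewrite -mulr_sumr.
congr (_ * _).
rewrite (pair_big xpredT xpredT (fun a (x : n.-tuple A) => g (rcons w a ++ x)))/=.
rewrite (reindex (fun ax : A * n.-tuple A => [tuple of ax.1 :: ax.2]))/=; last first.
  exists (fun y => (thead y, [tuple of behead y])) => [[a x] _|y _] /=.
    by congr pair; apply: val_inj.
  by rewrite [RHS]tuple_eta; apply: val_inj.
by apply: eq_bigr => -[a x] _; rewrite cat_rcons.
Qed.

(** The tower property of conditional expectation. *)
Lemma word_mean_tower n k g w : word_mean (n + k) g w = word_mean n (word_mean k g) w.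
Proof.
elim: n w => [|n IH] w; first by rewrite word_mean0.
by rewrite addSn !word_meanS; congr (_ * _); apply: eq_bigr => a _.
Qed.

Lemma eq_word_mean n g h w :
  (forall x, size x = n -> g (w ++ x) = h (w ++ x)) -> word_mean n g w = word_mean n h w.
Proof.
by move=> gh; congr (_ * _); apply: eq_bigr => x _; rewrite gh ?size_tuple.
Qed.

Lemma le_word_mean n g h w :
  (forall x, size x = n -> g (w ++ x) <= h (w ++ x)) ->
  word_mean n g w <= word_mean n h w.
Proof.
move=> gh; rewrite ler_wpM2l ?invr_ge0 ?exprn_ge0//.
by apply: ler_sum => x _; rewrite gh ?size_tuple.
Qed.

Lemma word_mean_cst n (c : R) w : word_mean n (fun=> c) w = c.
Proof.
rewrite /word_mean sumr_const card_tuple card_ord -[c *+ _]mulr_natl natrX mulrA.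
by rewrite mulVf ?mul1r// expf_neq0// pnatr_eq0.
Qed.

Lemma word_meanD n g h w :
  word_mean n (fun v => g v + h v) w = word_mean n g w + word_mean n h w.
Proof. by rewrite /word_mean big_split mulrDr. Qed.

Lemma word_meanZ n (c : R) g w : word_mean n (fun v => c * g v) w = c * word_mean n g w.
Proof. by rewrite /word_mean -mulr_sumr mulrCA. Qed.

(** The martingale property with respect to the letters: as all letters are
    equally likely, conditioning on the word so far is averaging over the next
    letter. *)
Definition word_martingale F := forall w, F w = word_mean 1 F w.

Lemma word_martingale_word_mean F n w : word_martingale F -> word_mean n F w = F w.
Proof.
move=> hF; elim: n w => [|n IH] w; first exact: word_mean0.
rewrite -addn1 word_mean_tower -[RHS]IH; apply: eq_word_mean => x _.
by rewrite -hF.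
Qed.

(** Orthogonality of the increments: the mean of [F w * F v] over the extensions
    [v] of [w] is [F w ^+ 2], by the martingale property. *)
Lemma word_mean_sqrB F n w : word_martingale F ->
  word_mean n (fun v => (F v - F w) ^+ 2) w
  = word_mean n (fun v => F v ^+ 2) w - F w ^+ 2.
Proof.
move=> hF.
rewrite (@eq_word_mean _ _ (fun v =>
    F v ^+ 2 + ((- (F w *+ 2)) * F v + F w ^+ 2))); last by move=> x _; ring.
rewrite word_meanD word_meanD word_meanZ word_mean_cst.
by rewrite (word_martingale_word_mean n w hF); ring.
Qed.

Lemma word_mean_sqr_ge F n w : word_martingale F ->
  F w ^+ 2 <= word_mean n (fun v => F v ^+ 2) w.
Proof.
move=> hF; rewrite -subr_ge0 -word_mean_sqrB// -(word_mean_cst n 0 w).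
by apply: le_word_mean => x _; exact: sqr_ge0.
Qed.

(** A condition on the finite word alone, so that its probability is a finite
    average. *)
Definition exceeds g (N : nat) (lam : R) w : bool :=
  [exists k : 'I_(size w).+1, (N <= k)%N && (lam < g (take k w))].

Lemma exceedsP g N lam w :
  reflect (exists2 k, (N <= k <= size w)%N & lam < g (take k w))
          (exceeds g N lam w).
Proof.
apply: (iffP existsP) => [[k /andP[Nk gk]]|[k /andP[Nk kw] gk]].
  by exists k => //; rewrite Nk -ltnS /=.
by exists (Ordinal (kw : (k < (size w).+1)%N)); rewrite Nk.
Qed.

Lemma submartingale_word_mean g N n w :
  (forall v, (N <= size v)%N -> g v <= word_mean 1 g v) ->
  (N <= size w)%N -> g w <= word_mean n g w.
Proof.
move=> sub; elim: n w => [|n IH] w Nw; first by rewrite word_mean0.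
apply: (le_trans (IH _ Nw)); rewrite -addn1 word_mean_tower.
by apply: le_word_mean => x _; apply: sub; rewrite size_cat (leq_trans Nw)// leq_addr.
Qed.

(** Doob's maximal inequality for nonnegative submartingales, started at a word
    [w] none of whose proper prefixes exceeds the threshold. The induction is on
    the number [n] of letters still to come. If [g w] exceeds [lam], the
    submartingale property alone gives the bound; otherwise [rcons w a] satisfies
    the same hypotheses for every letter [a], and the bounds for the letters are
    averaged. This replaces the usual stopping time. *)
Lemma doob_maximal g N lam n w :
  0 <= lam -> (forall v, 0 <= g v) ->
  (forall v, (N <= size v)%N -> g v <= word_mean 1 g v) ->
  (N <= size w)%N ->
  (forall k, (N <= k < size w)%N -> g (take k w) <= lam) ->
  lam * word_mean n (fun v => (exceeds g N lam v)%:R) w <= word_mean n g w.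
Proof.
move=> lam0 g0 sub; elim: n w => [|n IH] w Nw before.
  rewrite !word_mean0; case: exceedsP => [[k /andP[Nk]]|_]; last by rewrite mulr0.
  rewrite leq_eqVlt => /predU1P[->|kw].
    by rewrite take_size mulr1 => /ltW.
  by rewrite ltNge before// Nk.
have [gw|gw] := ltP lam (g w).
  rewrite (le_trans _ (submartingale_word_mean n.+1 sub Nw))// (le_trans _ (ltW gw))//.
  rewrite -[leRHS]mulr1 ler_wpM2l// -[leRHS](word_mean_cst n.+1 1 w).
  by apply: le_word_mean => x _; case: exceeds; rewrite ?ler01.
rewrite !word_meanS mulrCA ler_wpM2l ?invr_ge0// mulr_sumr.
apply: ler_sum => a _; apply: IH; rewrite size_rcons ?(leq_trans Nw)//.
move=> k /andP[Nk]; rewrite ltnS => kw.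
rewrite -cats1 take_cat; move: kw; rewrite leq_eqVlt => /predU1P[->|kw].
  by rewrite ltnn subnn take0 cats0.
by rewrite kw before// Nk.
Qed.

Definition moment2 F n : R := word_mean n (fun v => F v ^+ 2) [::].

Lemma moment2_nondecreasing F m n : word_martingale F -> (m <= n)%N ->
  moment2 F m <= moment2 F n.
Proof.
move=> hF /subnKC <-; rewrite /moment2 word_mean_tower.
by apply: le_word_mean => x _; exact: word_mean_sqr_ge.
Qed.

Lemma word_mean_sqr_incr F N n : word_martingale F ->
  word_mean (N + n) (fun v => (F v - F (take N v)) ^+ 2) [::]
  = moment2 F (N + n) - moment2 F N.
Proof.
move=> hF; rewrite /moment2 !word_mean_tower.
rewrite (@eq_word_mean _ _ (fun w =>
    word_mean n (fun v => F v ^+ 2) w + (-1) * F w ^+ 2)).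
  by rewrite word_meanD (word_meanZ _ (-1)) mulN1r.
move=> x xN; rewrite cat0s mulN1r -word_mean_sqrB//; apply: eq_word_mean => y _.
by rewrite -xN take_size_cat.
Qed.

(** After the first [N] letters [F (take N v)] is a constant, so the squared
    deviation from it is a submartingale from then on and the maximal inequality
    applies below every word of length [N]. *)
Lemma doob_sqr_incr F N n lam : word_martingale F -> 0 <= lam ->
  lam * word_mean (N + n) (fun v =>
    (exceeds (fun u => (F u - F (take N u)) ^+ 2) N lam v)%:R) [::]
  <= moment2 F (N + n) - moment2 F N.
Proof.
move=> hF lam0; rewrite -word_mean_sqr_incr// !word_mean_tower -word_meanZ.
apply: le_word_mean => x xN; rewrite cat0s; apply: doob_maximal => //.
- by move=> v; exact: sqr_ge0.
- move=> v Nv.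
  rewrite (@eq_word_mean _ _ (fun u => F u ^+ 2 +
     ((- (F (take N v) *+ 2)) * F u + F (take N v) ^+ 2))); last first.
    by move=> y _; rewrite take_cat; move: Nv; rewrite leq_eqVlt => /predU1P[->|->];
      rewrite ?ltnn ?subnn ?take0 ?cats0 ?take_size; ring.
  rewrite word_meanD word_meanD word_meanZ word_mean_cst -hF.
  have := word_mean_sqr_ge 1 v hF.
  by move=> H; rewrite sqrrB; lra.
- by rewrite xN.
- by move=> k; rewrite xN; case/andP => H1 H2; have := leq_ltn_trans H1 H2; rewrite ltnn.
Qed.
End WordAverages.

(** * The product measure on prefixes *)

Section Cylinders.
Context {R : realType} {p : nat}.
Local Notation A := 'I_p.+1.

Definition cylinder n (x : n.-tuple A) : set (Omega p) :=
  [set w | word_upto n w = x].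

Lemma measurable_coord i (B : set A) :
  measurable ([set w | B (w i)] : set (Omega p)).
Proof.
apply: sub_sigma_algebra; exists i => //.
by exists B => //; rewrite setTI.
Qed.

(** A cylinder is a finite intersection of conditions on single letters, the
    form to which the independence of the coordinates applies. *)
Lemma cylinderE n (x : n.-tuple A) :
  cylinder x = \bigcap_(i in [set` [fset i in iota 0 n]%fset])
    [set w | [set a | a = nth ord0 x i] (w i)].
Proof.
apply/seteqP; split => w /=.
  move=> <- i /=; rewrite in_fset/= mem_iota => /andP[_ ni].
  by rewrite (nth_mktuple _ _ (Ordinal ni)).
move=> wx; apply: eq_from_tnth => i; rewrite tnth_mktuple (tnth_nth ord0).
by apply: wx => /=; rewrite in_fset/= mem_iota/=.
Qed.

Lemma measurable_cylinder n (x : n.-tuple A) : measurable (cylinder x).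
Proof.
rewrite cylinderE; apply: fin_bigcap_measurable => // i _.
exact: measurable_coord.
Qed.

Lemma mu_cylinder (mu : probability (Omega p) R) n (x : n.-tuple A) :
  uniform_product_measure mu -> mu (cylinder x) = (p.+1%:R ^- n)%:E.
Proof.
move=> [unif indep]; rewrite cylinderE (indep _ (fun i => [set a | a = nth ord0 x i])).
under eq_bigr do rewrite /= unif.
rewrite prodEFin big_const_seq iter_mulr_1 exprVn; congr (_ ^- _)%:E.
rewrite count_predT -[RHS](size_iota 0) -[in RHS](undup_id (iota_uniq 0 n)).
exact: card_fseq.
Qed.

Lemma word_fun_sum n (g : seq A -> R) (w : Omega p) :
  g (word_upto n w) = \sum_(x : n.-tuple A) g x * \1_(cylinder x) w.
Proof.
rewrite (bigD1 (word_upto n w))//= indicE mem_set// mulr1 big1 ?addr0//.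
move=> x /eqP xw; rewrite indicE memNset ?mulr0//= => wx; exact/xw/esym.
Qed.

Lemma measurable_word_fun n (g : seq A -> R) :
  measurable_fun setT (fun w : Omega p => g (word_upto n w)).
Proof.
under [X in measurable_fun _ X]funext do rewrite word_fun_sum.
apply: measurable_sum => x; apply: measurable_funM => //.
exact: measurable_indic (measurable_cylinder x).
Qed.

(** The bridge between the measure and the averages over words: a function of
    [n] letters is a combination of indicators of cylinders of equal measure. *)
Lemma integral_word_fun (mu : probability (Omega p) R) n (g : seq A -> R) :
  uniform_product_measure mu ->
  (\int[mu]_w (g (word_upto n w))%:E = (word_mean n g [::])%:E)%E.
Proof.
move=> mu_prod.
have mC (x : n.-tuple A) := measurable_cylinder x.
under eq_integral do rewrite word_fun_sum -sumEFin.
under eq_integral do under eq_bigr do rewrite EFinM.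
rewrite integral_sum//; last first.
  by move=> x; apply: integrableZl => //; exact: integrable_indic.
rewrite /word_mean mulr_sumr -sumEFin; apply: eq_bigr => x _.
rewrite integralZl//; last exact: integrable_indic.
by rewrite integral_indic// setIT [X in (_ * X)%E](mu_cylinder x mu_prod) -EFinM mulrC.
Qed.

Lemma measurable_word n (P : seq A -> bool) :
  measurable ([set w | P (word_upto n w)] : set (Omega p)).
Proof.
have := @measurable_word_fun n (fun v => (P v)%:R).
move=> /(_ measurableT _ (measurable_set1 1)); rewrite setTI.
congr measurable; apply/seteqP; split => w /=; case: (P _) => //= /eqP.
by rewrite eq_sym oner_eq0.
Qed.

Lemma mu_word (mu : probability (Omega p) R) n (P : seq A -> bool) :
  uniform_product_measure mu ->
  (mu [set w | P (word_upto n w)] = (word_mean n (fun v => (P v)%:R) [::])%:E)%E.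
Proof.
move=> mu_prod; rewrite -(integral_word_fun n _ mu_prod).
rewrite -[X in mu X]setIT -integral_indic//; last exact: measurable_word.
apply: eq_integral => w _; rewrite indicE; congr ((nat_of_bool _)%:R%:E).
by apply/idP/idP => [/set_mem//|Pw]; exact/mem_set.
Qed.
End Cylinders.

(** * Convergence of martingales bounded in L^2 *)

(** A Cauchy criterion with the thresholds [1 / (j + 1)], so that its failure
    is a countable union of events. *)
Lemma sqr_increments_cvg (R : realType) (u : nat -> R) :
  (forall j : nat, exists N, forall k, (N <= k)%N ->
     (u k - u N) ^+ 2 <= j.+1%:R^-1) ->
  cvgn u.
Proof.
move=> H; apply/cauchy_cvgP; apply: cauchy_exP => e e0.
have e20 : 0 < e ^+ 2 by rewrite exprn_gt0.
have [j je] : exists j : nat, j.+1%:R^-1 < e ^+ 2.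
  by have [j _ /(_ j (leqnn j))] := near_infty_natSinv_lt (PosNum e20); exists j.
have [N HN] := H j; exists (u N); exists N => // k Nk.
rewrite /ball/= distrC -ltr_sqr ?nnegrE ?normr_ge0 ?(ltW e0)//.
rewrite -normrX ger0_norm ?sqr_ge0//.
exact: le_lt_trans (HN k Nk) je.
Qed.

Section L2Martingale.
Context {R : realType} {p : nat} (mu : probability (Omega p) R).
Hypothesis mu_prod : uniform_product_measure mu.
Local Notation A := 'I_p.+1.
Variables (F : seq A -> R) (C : R).
Hypotheses (hF : word_martingale F) (F_bound : forall n, moment2 F n <= C).

Local Notation X n := (fun w : Omega p => F (word_upto n w)).

Local Notation V := (limn (moment2 F)).

Lemma take_word_upto N n (w : Omega p) : (N <= n)%N ->
  take N (word_upto n w) = word_upto N w.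
Proof.
move=> Nn; apply: (@eq_from_nth _ ord0).
  by rewrite size_takel ?size_tuple.
rewrite size_takel ?size_tuple// => i iN; rewrite nth_take//.
rewrite (nth_mktuple _ _ (Ordinal iN))/=.
by rewrite (nth_mktuple _ _ (Ordinal (leq_trans iN Nn))).
Qed.

Lemma cvg_moment2 : moment2 F @ \oo --> V.
Proof.
apply: nondecreasing_is_cvgn; first by move=> m n; exact: moment2_nondecreasing.
by exists C => _ [n _ <-].
Qed.

Lemma moment2_le n : moment2 F n <= V.
Proof.
apply: nondecreasing_cvgn_le; last exact: cvg_moment2.
by move=> m k; exact: moment2_nondecreasing.
Qed.

Lemma moment2_near e : 0 < e -> exists N, V - moment2 F N <= e.
Proof.
move=> e0; have /cvgrPdist_le/(_ e e0)[N _ HN] := cvg_moment2.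
by exists N; rewrite (le_trans _ (HN N (leqnn N)))//= ler_norm.
Qed.

Definition oscillation N lam : set (Omega p) :=
  [set w | exists2 k, (N <= k)%N & lam < (X k w - X N w) ^+ 2].

Lemma oscillationE N lam : oscillation N lam =
  \bigcup_n [set w | exceeds (fun u => (F u - F (take N u)) ^+ 2) N lam
                       (word_upto (N + n) w)].
Proof.
apply/seteqP; split => w.
  move=> [k Nk wk]; exists (k - N)%N => //; rewrite /mkset subnKC//.
  apply/exceedsP; exists k; first by rewrite Nk size_tuple/=.
  by rewrite !take_word_upto.
move=> [n _]; rewrite /mkset => /exceedsP[k]; rewrite size_tuple => /andP[Nk kn].
by rewrite take_word_upto// take_word_upto// => wk; exists k.
Qed.

Lemma measurable_oscillation N lam : measurable (oscillation N lam).
Proof.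
rewrite oscillationE; apply: bigcup_measurable => n _.
exact: measurable_word.
Qed.

(** The event is the increasing union, over the number of letters, of events to
    which the maximal inequality applies with a bound that does not depend on
    that number. *)
Lemma mu_oscillation N lam : 0 < lam ->
  (mu (oscillation N lam) <= ((V - moment2 F N) / lam)%:E)%E.
Proof.
move=> lam0; rewrite oscillationE.
have mE n : measurable [set w : Omega p |
    exceeds (fun u => (F u - F (take N u)) ^+ 2) N lam (word_upto (N + n) w)].
  exact: measurable_word.
have sE : nondecreasing_seq (fun n => [set w : Omega p |
    exceeds (fun u => (F u - F (take N u)) ^+ 2) N lam (word_upto (N + n) w)]).
  move=> m n mn; apply/subsetPset => w; rewrite /mkset => /exceedsP[k].
  rewrite size_tuple => /andP[Nk km].
  have kn : (k <= N + n)%N by rewrite (leq_trans km)// leq_add2l.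
  rewrite take_word_upto// => H; apply/exceedsP; exists k.
    by rewrite size_tuple Nk.
  by rewrite take_word_upto.
have cE := nondecreasing_cvg_mu mE (bigcup_measurable (fun n _ => mE n)) sE.
rewrite -(cvg_lim _ (cE _ mu))//; apply: lime_le.
  by apply/cvg_ex; eexists; exact: cE.
apply: nearW => n /=; rewrite mu_word// lee_fin ler_pdivlMr// mulrC.
by rewrite (le_trans (doob_sqr_incr _ _ hF (ltW lam0)))// lerB// moment2_le.
Qed.

(** A path that is not Cauchy oscillates by a fixed amount after every time [N],
    and the probability of this tends to 0 as the second moments converge. *)
Lemma ae_cvg : {ae mu, forall w, cvgn (fun n => X n w)}.
Proof.
apply: (@negligibleS _ _ _ _ (\bigcup_j \bigcap_N oscillation N j.+1%:R^-1)).
  move=> w /= ncv; apply: contrapT => H; apply: ncv.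
  apply: sqr_increments_cvg => j.
  apply: contrapT => /forallNP H1; apply: H; exists j => // N _.
  apply: contrapT => H2; apply: (H1 N) => k Nk; rewrite leNgt; apply/negP => H3.
  by apply: H2; exists k.
apply: negligible_bigcup => j.
have mO : measurable (\bigcap_N oscillation N j.+1%:R^-1).
  by apply: bigcapT_measurable => N; exact: measurable_oscillation.
exists (\bigcap_N oscillation N j.+1%:R^-1); split => //.
apply/eqP; rewrite -measure_le0; apply/lee_addgt0Pr => e e0.
rewrite add0e.
have ej : 0 < e / j.+1%:R by rewrite divr_gt0.
have [N HN] := moment2_near ej.
apply: (@le_trans _ _ (mu (oscillation N j.+1%:R^-1))).
  apply: le_measure; rewrite ?inE//; first exact: measurable_oscillation.
  by move=> w; apply.
apply: (le_trans (mu_oscillation N _)) => //.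
by rewrite lee_fin invrK -ler_pdivlMr.
Qed.

(** The upper limit makes the limit function total and measurable without
    removing the null set of divergent paths. *)
Definition word_limit (w : Omega p) : R :=
  fine (limn_esup (fun n => (X n w)%:E)).

Lemma measurable_word_limit : measurable_fun setT word_limit.
Proof.
apply: measurableT_comp; first exact: fine_measurable.
apply: measurable_fun_limn_esup => n; apply/measurable_EFinP.
exact: measurable_word_fun.
Qed.

Lemma cvg_word_limit w : cvgn (fun n => X n w) ->
  (fun n => X n w) @ \oo --> word_limit w.
Proof.
move=> /cvg_ex[l Xl].
have Xl' : (fun n => (X n w)%:E) @ \oo --> l%:E by apply: cvg_EFin => //; exact: nearW.
rewrite /word_limit is_cvg_limn_esupE; last by apply/cvg_ex; exists l%:E.
by rewrite (cvg_lim _ Xl').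
Qed.

Lemma ae_word_limit : {ae mu, forall w, (fun n => X n w) @ \oo --> word_limit w}.
Proof. by apply: filterS ae_cvg; exact: cvg_word_limit. Qed.

(** Fatou's lemma along [k] for the squares of [X (n + k) - X n], whose integrals
    are differences of second moments and so at most [V - moment2 F n]. *)
Lemma L2_word_limit n :
  (\int[mu]_w ((X n w - word_limit w) ^+ 2)%:E <= (V - moment2 F n)%:E)%E.
Proof.
pose f k w : \bar R := ((X (n + k) w - X n w) ^+ 2)%:E.
have mf k : measurable_fun setT (f k).
  apply/measurable_EFinP/measurable_funX/measurable_funB;
  exact: measurable_word_fun.
have If k : (\int[mu]_w f k w = (moment2 F (n + k) - moment2 F n)%:E)%E.
  rewrite -word_mean_sqr_incr// -(integral_word_fun _ _ mu_prod).
  by apply: eq_integral => w _; rewrite take_word_upto// leq_addr.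
have f0 k w : [set: Omega p] w -> (0 <= f k w)%E by rewrite lee_fin sqr_ge0.
have mY : measurable_fun setT (fun w => ((X n w - word_limit w) ^+ 2)%:E).
  apply/measurable_EFinP/measurable_funX/measurable_funB.
    exact: measurable_word_fun.
  exact: measurable_word_limit.
rewrite (@ge0_ae_eq_integral _ _ _ mu _ _ (fun w => limn_einf (f ^~ w)))//.
- apply: (le_trans (fatou mu measurableT mf f0)).
  rewrite (_ : (fun k => _) = fun k => (moment2 F (n + k) - moment2 F n)%:E); last first.
    by apply/funext => k; exact: If.
  have cV : (fun k => (moment2 F (n + k) - moment2 F n)%:E) @ \oo -->
      (V - moment2 F n)%:E.
    apply: cvg_EFin; first exact: nearW.
    apply: cvgB; last exact: cvg_cst.
    exact: cvg_comp (@cvg_addnl n) cvg_moment2.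
  rewrite is_cvg_limn_einfE; last by apply/cvg_ex; eexists; exact: cV.
  by rewrite (cvg_lim _ cV).
- apply: measurableT_comp => //.
  apply: (@measurable_fun_limn_esup _ _ _ _ (fun k w => - f k w)%E) => k.
  exact: measurableT_comp (mf k).
- by move=> w _; rewrite lee_fin sqr_ge0.
- move=> w _; rewrite limn_einf_lim; apply: lime_ge; first exact: is_cvg_einfs.
  apply: nearW => k; apply: le_ereal_inf_tmp => _ [j _ <-].
  by rewrite lee_fin sqr_ge0.
- apply: filterS ae_word_limit => w Xw _.
  have cX : f ^~ w @ \oo --> ((X n w - word_limit w) ^+ 2)%:E.
    apply: cvg_EFin; first exact: nearW.
    rewrite (_ : (X n w - word_limit w) ^+ 2 =
      (word_limit w - X n w) * (word_limit w - X n w)); last by ring.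
    rewrite /f /comp/=; under eq_fun do rewrite expr2.
    have cB : (fun k => X (n + k)%N w - X n w) @ \oo --> word_limit w - X n w.
      apply: cvgB; last exact: cvg_cst.
      exact: (@cvg_comp _ _ _ (addn n) (fun k => X k w) _ _ _ (@cvg_addnl n)).
    exact: cvgM.
  rewrite is_cvg_limn_einfE; last by apply/cvg_ex; eexists; exact: cX.
  by rewrite (cvg_lim _ cX).
Qed.

End L2Martingale.

(** Integrates the pointwise bound [|z| <= r + z ^+ 2 / r]; with [r] free, it does
    the work of the Cauchy-Schwarz inequality. *)
Lemma abse_integral_le_sqr d (T : measurableType d) (R : realType)
    (P : probability T R) (Z : T -> R) (e r : R) :
  measurable_fun setT Z -> 0 < r ->
  (\int[P]_w (Z w ^+ 2)%:E <= e%:E)%E ->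
  (\int[P]_w `|Z w|%:E <= (r + e / r)%:E)%E.
Proof.
move=> mZ r0 Ze.
have mZ2 : measurable_fun setT (fun w => (r^-1)%:E * (Z w ^+ 2)%:E)%E.
  by apply/measurable_EFinP/measurable_funM => //; exact: measurable_funX.
apply: (@le_trans _ _ (\int[P]_w (r%:E + (r^-1)%:E * (Z w ^+ 2)%:E)))%E.
  apply: ge0_le_integral => //.
  - by apply/measurable_EFinP; exact: measurableT_comp.
  - exact: emeasurable_funD.
  move=> w _; rewrite lee_fin.
  have [Zr|/ltW Zr] := leP `|Z w| r.
    by rewrite (le_trans Zr)// lerDl mulr_ge0// ?sqr_ge0// invr_ge0 ltW.
  rewrite -real_normK ?num_real// ler_wpDl ?(ltW r0)//.
  by rewrite mulrC ler_pdivlMr// expr2 ler_wpM2l.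
rewrite ge0_integralD//; last 2 first.
- by move=> w _; rewrite lee_fin ltW.
- by move=> w _; rewrite mule_ge0// lee_fin ?sqr_ge0// invr_ge0 ltW.
rewrite integral_cst//
  [X in (_ * X)%E](@probability_setT _ _ _ P) mule1 EFinD leeD2l//.
rewrite ge0_integralZl//; first by rewrite mulrC EFinM lee_wpmul2l// lee_fin invr_ge0 ltW.
- by apply/measurable_EFinP/measurable_funX.
- by move=> w _; rewrite lee_fin sqr_ge0.
- by rewrite lee_fin invr_ge0 ltW.
Qed.

Lemma sqr_integrable d (T : measurableType d) (R : realType)
    (P : probability T R) (Z : T -> R) (e : R) :
  measurable_fun setT Z -> (\int[P]_w (Z w ^+ 2)%:E <= e%:E)%E ->
  P.-integrable setT (EFin \o Z).
Proof.
move=> mZ Ze; apply/integrableP; split; first exact/measurable_EFinP.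
exact: le_lt_trans (abse_integral_le_sqr mZ ltr01 Ze) (ltry _).
Qed.

(** The limit is the pathwise one. Its mean is found by comparing it with the
    constant mean of [F (word_upto n w)], using that the distance in L^1 is
    controlled by the distance in L^2. *)
Lemma word_martingale_L2_convergence (R : realType) (p : nat)
    (mu : probability (Omega p) R) (F : seq 'I_p.+1 -> R) (C : R) :
  uniform_product_measure mu ->
  word_martingale F -> (forall n, moment2 F n <= C) ->
  exists Y : Omega p -> R,
  [/\ measurable_fun setT Y,
      (\int[mu]_w (Y w ^+ 2)%:E < +oo)%E,
      (\int[mu]_w ((F (word_upto n w) - Y w) ^+ 2)%:E @[n --> \oo] --> 0)%E,
      {ae mu, forall w, (fun n => F (word_upto n w)) @ \oo --> Y w} &
      (\int[mu]_w (Y w)%:E = (F [::])%:E)%E].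
Proof.
move=> mu_prod hF FC; pose Y := word_limit (p := p) F; exists Y.
have mY : measurable_fun setT Y := measurable_word_limit F.
have mX n := measurable_word_fun (p := p) n F.
have mXY n : measurable_fun setT (fun w : Omega p => F (word_upto n w) - Y w).
  exact: measurable_funB.
pose V := limn (moment2 F).
have cV : moment2 F @ \oo --> V := cvg_moment2 hF FC.
have L2 n := L2_word_limit mu_prod hF FC n.
have cV0 : (fun n => (V - moment2 F n)%:E) @ \oo --> 0%E.
  apply: cvg_EFin; first exact: nearW.
  by rewrite -[X in _ --> X](subrr V); apply: cvgB => //; exact: cvg_cst.
have Y2 : (\int[mu]_w (Y w ^+ 2)%:E <= (2 * (V - moment2 F 0) + 2 * moment2 F 0)%:E)%E.
  have m2 (Z : Omega p -> R) : measurable_fun setT Z ->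
      measurable_fun setT (fun w => 2%:E * (Z w ^+ 2)%:E)%E.
    by move=> mZ; apply/measurable_EFinP/measurable_funM => //; exact: measurable_funX.
  apply: (@le_trans _ _ (\int[mu]_w (2%:E * ((F (word_upto 0 w) - Y w) ^+ 2)%:E
      + 2%:E * (F (word_upto 0 w) ^+ 2)%:E)))%E.
    apply: ge0_le_integral => //.
    - by move=> w _; rewrite lee_fin sqr_ge0.
    - by apply/measurable_EFinP; exact: measurable_funX.
    - by apply: emeasurable_funD; apply: m2.
    move=> w _; rewrite lee_fin.
    (* With [x] the value of [F], the difference of the two sides
       [2 (x - Y) ^+ 2 + 2 x ^+ 2] and [Y ^+ 2] is the square of [2 x - Y]. *)
    have : 0 <= (2 * F (word_upto 0 w) - Y w) ^+ 2 by exact: sqr_ge0.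
    by move: (F _) (Y w) => a b; nra.
  have sq0 (Z : Omega p -> R) w : [set: Omega p] w -> (0 <= (Z w ^+ 2)%:E)%E.
    by rewrite lee_fin sqr_ge0.
  rewrite ge0_integralD//; [|by move=> w _; rewrite mule_ge0// lee_fin sqr_ge0|exact: m2
    |by move=> w _; rewrite mule_ge0// lee_fin sqr_ge0|exact: m2].
  rewrite !ge0_integralZl//; [|by apply/measurable_EFinP; exact: measurable_funX
    |exact: sq0|by apply/measurable_EFinP; exact: measurable_funX|exact: sq0].
  have -> : (2 * (V - moment2 F 0) + 2 * moment2 F 0)%:E =
    (2%:E * (V - moment2 F 0)%:E + 2%:E * (moment2 F 0)%:E)%E by [].
  apply: leeD; apply: lee_wpmul2l => //.
  by rewrite (integral_word_fun 0 (fun v => F v ^+ 2) mu_prod).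
split => //.
- by apply: le_lt_trans Y2 _; exact: ltry.
- apply: squeeze_cvge cV0; last exact: cvg_cst.
  apply: nearW => n; rewrite (L2 n) andbT.
  by apply: integral_ge0 => w _; rewrite lee_fin sqr_ge0.
- exact: ae_word_limit hF FC.
have iY := sqr_integrable mY Y2.
have iX n : mu.-integrable setT (fun w => (F (word_upto n w))%:E).
  apply: (sqr_integrable (e := moment2 F n)) => //.
  by rewrite (integral_word_fun n (fun v => F v ^+ 2) mu_prod).
have [y Ey] : exists y, (\int[mu]_w (Y w)%:E = y%:E)%E.
  by exists (fine (\int[mu]_w (Y w)%:E)); rewrite fineK//; exact: integrable_fin_num iY.
rewrite Ey; congr EFin; apply/eqP; rewrite -subr_eq0 -normr_le0.
apply/ler_addgt0Pr => r r0; rewrite add0r.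
(* The means of [Y] and of [X_n] differ by at most [r + (V - moment2 F n) / r],
   and this tends to [r]. *)
have cr : (fun n => r + (V - moment2 F n) / r) @ \oo --> r.
  rewrite -[X in _ --> X]addr0 -(mul0r r^-1) -(subrr V).
  apply: cvgD; first exact: cvg_cst.
  apply: cvgMl; apply: cvgB => //; exact: cvg_cst.
apply: (cvgr_to_ge cr); apply: nearW => n.
rewrite -lee_fin; apply: le_trans (abse_integral_le_sqr (mXY n) r0 (L2 n)).
have -> : (`|y - F [::]|%:E = `|\int[mu]_w (F (word_upto n w) - Y w)%:E|)%E.
  under eq_integral do rewrite EFinB.
  rewrite (@integralB _ _ _ mu _ measurableT _ (EFin \o Y) (iX n) iY).
  rewrite (integral_word_fun n F mu_prod) /= Ey (word_martingale_word_mean n [::] hF).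
  by rewrite distrC.
apply: le_abse_integral => //; exact/measurable_EFinP.
Qed.

(** * Positive definite kernels and the invariant limit kernel *)

(** The norm of [R[i]] takes its values in [R[i]], and so do the radii of its
    balls: a positive radius is a real number with zero imaginary part. *)
Lemma cvg_complex (R : realType) (T : Type) (G : set_system T)
    (FG : Filter G) (f : T -> R[i]) (a b : R) :
  (fun n => complex.Re (f n)) @ G --> a ->
  (fun n => complex.Im (f n)) @ G --> b ->
  (fun n => f n : R[i]^o) @ G --> (Complex a b : R[i]^o).
Proof.
move=> /cvgrPdist_lt Ha /cvgrPdist_lt Hb; apply/cvgrPdist_lt => -[e e'].
rewrite ltcE /= => /andP[/eqP-> e0].
have e20 : 0 < e / 2 by rewrite divr_gt0.
near=> n.
have Ea : `|a - complex.Re (f n)| < e / 2 by near: n; exact: Ha.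
have Eb : `|b - complex.Im (f n)| < e / 2 by near: n; exact: Hb.
move: Ea Eb; case: (f n) => x y /= Ea Eb.
rewrite ltcE /= eqxx /=.
rewrite -ltr_sqr ?nnegrE ?sqrtr_ge0 ?(ltW e0)// sqr_sqrtr ?addr_ge0 ?sqr_ge0//.
move: Ea Eb; rewrite !ltr_norml => /andP[? ?] /andP[? ?].
nra.
Unshelve. all: by end_near. Qed.

Section PositiveDefinite.
Context {R : realType} {Y : Type}.
Implicit Types J D : ckernel R Y.

Lemma pd_two_points D s t (z : R[i]) : positive_definite D ->
  0 <= D s s + z * D s t + (Num.conj z * D t s + Num.conj z * z * D t t).
Proof.
move=> /(_ 2 (fun a => if a == ord0 then 1 else z) (fun a => if a == ord0 then s else t)).
by rewrite !big_ord_recl !big_ord0 /= !addr0 !rmorph1 !mul1r !mulr1.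
Qed.

Lemma pd_diag_ge0 D s : positive_definite D -> 0 <= complex.Re (D s s).
Proof.
move=> /(@pd_two_points _ s s 0); rewrite rmorph0 !mul0r !addr0.
by rewrite lecE => /andP[].
Qed.

(** Testing positive definiteness on the vectors (1, z) with z = 1, -1, i, -i:
    the sums must be real, which makes the kernel Hermitian, and nonnegative,
    which gives the two-sided bounds. The arithmetic mean on the right is weaker
    than the geometric one, but it is linear in the kernel, so the bounds for the
    increments of a sequence of kernels telescope. *)
Lemma pd_entry_le D s t : positive_definite D ->
  `|complex.Re (D s t)| <= (complex.Re (D s s) + complex.Re (D t t)) / 2 /\
  `|complex.Im (D s t)| <= (complex.Re (D s s) + complex.Re (D t t)) / 2.
Proof.
move=> D0.
have H z := @pd_two_points _ s t z D0.
have := H 1; have := H (-1); have := H (Complex 0 1); have := H (Complex 0 (-1)).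
move: (D s s) (D s t) (D t s) (D t t) => [a a'] [b b'] [c c'] [d d'].
rewrite !lecE /= => /andP[/eqP h1 h1'] /andP[/eqP h2 h2'].
move=> /andP[/eqP h3 h3'] /andP[/eqP h4 h4'].
by split; rewrite ler_norml; apply/andP; split; lra.
Qed.
End PositiveDefinite.

Section KernelIteration.
Context {R : realType} {X : Type} {p : nat} (phi : 'I_p.+1 -> X -> X).
Variable K : ckernel R X.
Hypotheses (K_pd : positive_definite K) (K_le : kernel_le K (pullback phi K)).

Local Notation Kn := (Kn phi K).
Local Notation un := (un phi K).
Local Notation uinf := (uinf phi K).
Local Notation Kinf := (Kinf phi K).
Local Notation Xfin := (Xfin phi K).

Lemma pullback_pd (J : ckernel R X) :
  positive_definite J -> positive_definite (pullback phi J).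
Proof.
move=> J0 k c s; rewrite /pullback.
under eq_bigr do under eq_bigr do rewrite mulr_sumr.
under eq_bigr do rewrite exchange_big.
rewrite exchange_big; apply: sumr_ge0 => i _; exact: (J0 k c (fun a => phi i (s a))).
Qed.

Lemma Kn_pd n : positive_definite (Kn n).
Proof. by elim: n => // n IH; exact: pullback_pd. Qed.

(** The pullback preserves positive definiteness and is additive, so the
    hypothesis [K <= L K] propagates along the iteration. *)
Lemma Kn_incr_pd n : kernel_le (Kn n) (Kn n.+1).
Proof.
elim: n => // n /pullback_pd; rewrite /kernel_le; congr positive_definite.
by apply/funext => s; apply/funext => t; rewrite /pullback sumrB.
Qed.

Lemma un_nondecreasing s : nondecreasing_seq (un ^~ s).
Proof.
apply/nondecreasing_seqP => n.
have := pd_diag_ge0 s (Kn_incr_pd n); rewrite /un.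
by case: (Kn n.+1 s s) (Kn n s s) => a a' [b b'] /=; rewrite subr_ge0.
Qed.

Lemma un_ge0 n s : 0 <= un n s.
Proof. exact: pd_diag_ge0 (Kn_pd n). Qed.

Lemma unS n s : un n.+1 s = \sum_(i < p.+1) un n (phi i s).
Proof. by rewrite /un /Kn iterS /pullback raddf_sum. Qed.

Definition ufin s : R := fine (uinf s).

Lemma un_le_uinf n s : ((un n s)%:E <= uinf s)%E.
Proof.
have nd : nondecreasing_seq (fun k => (un k s)%:E).
  by move=> k l kl; rewrite lee_fin; exact: un_nondecreasing.
rewrite /Defs.uinf (cvg_lim _ (ereal_nondecreasing_cvgn nd))//.
by apply: ereal_sup_ubound; exists n.
Qed.

Lemma uinfE s : Xfin s -> uinf s = (ufin s)%:E.
Proof.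
move=> sfin; rewrite /ufin fineK// ge0_fin_numE//.
by apply: le_trans (un_le_uinf 0 s); rewrite lee_fin un_ge0.
Qed.

Lemma un_le_ufin n s : Xfin s -> un n s <= ufin s.
Proof. by move=> sfin; rewrite -lee_fin -uinfE// un_le_uinf. Qed.

Lemma Xfin_phi i s : Xfin s -> Xfin (phi i s).
Proof.
move=> sfin; rewrite /Defs.Xfin /=; apply: le_lt_trans (ltry (ufin s)).
apply: lime_le => //.
  apply: ereal_nondecreasing_is_cvgn => m n mn; rewrite lee_fin.
  exact: un_nondecreasing.
apply: nearW => n; rewrite lee_fin (le_trans _ (un_le_ufin n.+1 sfin))// unS.
by rewrite (bigD1 i)//= lerDl sumr_ge0// => j _; exact: un_ge0.
Qed.

Lemma Xfin_word w s : Xfin s -> Xfin (word_map phi w s).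
Proof.
by elim: w s => //= i w IH s sfin; apply: IH; exact: Xfin_phi.
Qed.

(** The sequence [v + u] is nondecreasing and bounded, as is [u]. *)
Lemma is_cvg_dominated_incr (v u : nat -> R) (M : R) :
  nondecreasing_seq u -> (forall n, u n <= M) ->
  (forall n, `|v n| <= u n) ->
  (forall n, `|v n.+1 - v n| <= u n.+1 - u n) ->
  cvgn v.
Proof.
move=> ndu uM vu dv.
have cu : cvgn u.
  by apply: nondecreasing_is_cvgn => //; exists M => _ [n _ <-].
have -> : v = (v \+ u) \- u by apply/funext => n /=; rewrite addrK.
apply: is_cvgB => //; apply: nondecreasing_is_cvgn.
  apply/nondecreasing_seqP => n /=; have := dv n; rewrite ler_norml => /andP[]; lra.
exists (M + M) => _ [n _ <-] /=; rewrite lerD//.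
by rewrite (le_trans (ler_norm _))// (le_trans (vu n)).
Qed.

(** The bound of an entry by the diagonal holds for the kernels [Kn n] and for
    their increments, and the diagonal is nondecreasing and bounded on [Xfin]. *)
Lemma Kn_entry_cvg s t : Xfin s -> Xfin t ->
  cvgn (fun n => complex.Re (Kn n s t)) /\ cvgn (fun n => complex.Im (Kn n s t)).
Proof.
move=> sfin tfin; pose u n := (un n s + un n t) / 2.
have ndu : nondecreasing_seq u.
  move=> m n mn; rewrite ler_wpM2r// lerD//; exact: un_nondecreasing.
have uM n : u n <= (ufin s + ufin t) / 2.
  by rewrite ler_wpM2r// lerD// un_le_ufin.
have ReB (x y : R[i]) : complex.Re (x - y) = complex.Re x - complex.Re y.
  by case: x; case: y.
have ImB (x y : R[i]) : complex.Im (x - y) = complex.Im x - complex.Im y.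
  by case: x; case: y.
split; apply: (@is_cvg_dominated_incr _ u _ ndu uM) => n.
- exact: (pd_entry_le s t (Kn_pd n)).1.
- have := (pd_entry_le s t (Kn_incr_pd n)).1.
  by rewrite !ReB => /le_trans; apply; rewrite /u /un; lra.
- exact: (pd_entry_le s t (Kn_pd n)).2.
- have := (pd_entry_le s t (Kn_incr_pd n)).2.
  by rewrite !ImB !ReB => /le_trans; apply; rewrite /u /un; lra.
Qed.

Lemma KinfE s t : Xfin s -> Xfin t ->
  Kinf s t = Complex (limn (fun n => complex.Re (Kn n s t)))
                     (limn (fun n => complex.Im (Kn n s t))).
Proof.
move=> sfin tfin; have [cRe cIm] := Kn_entry_cvg sfin tfin.
exact: (cvg_lim (@norm_hausdorff _ R[i]^o) (cvg_complex _ cRe cIm)).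
Qed.

Lemma cvg_Kn s t : Xfin s -> Xfin t ->
  (fun n => complex.Re (Kn n s t)) @ \oo --> complex.Re (Kinf s t) /\
  (fun n => complex.Im (Kn n s t)) @ \oo --> complex.Im (Kinf s t).
Proof.
by move=> sfin tfin; have [cRe cIm] := Kn_entry_cvg sfin tfin; rewrite KinfE.
Qed.

(** The recursion [Kn n.+1 = pullback phi (Kn n)] passes to the limit on both
    sides, [Xfin] being stable under the maps. *)
Lemma Kinf_invariant s t : Xfin s -> Xfin t ->
  Kinf s t = \sum_(i < p.+1) Kinf (phi i s) (phi i t).
Proof.
move=> sfin tfin.
have [cRe cIm] := cvg_Kn sfin tfin.
have cphi i := cvg_Kn (Xfin_phi i sfin) (Xfin_phi i tfin).
have lim_sum (f : 'I_p.+1 -> nat -> R) (l : 'I_p.+1 -> R) :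
    (forall i, f i @ \oo --> l i) ->
    (fun n => \sum_(i < p.+1) f i n) @ \oo --> \sum_(i < p.+1) l i.
  by move=> fl; apply: cvg_big => //; exact: add_continuous.
have KS n : Kn n.+1 s t = \sum_(i < p.+1) Kn n (phi i s) (phi i t) by [].
apply/eqP; rewrite eq_complex; apply/andP; split; apply/eqP; rewrite raddf_sum.
  have := lim_sum _ _ (fun i => (cphi i).1).
  under eq_fun do rewrite -raddf_sum -KS.
  move=> /(cvg_unique (@norm_hausdorff _ R)) H; apply: esym; apply: H.
  exact: cvg_comp (@cvg_addnl 1) cRe.
have := lim_sum _ _ (fun i => (cphi i).2).
under eq_fun do rewrite -raddf_sum -KS.
move=> /(cvg_unique (@norm_hausdorff _ R)) H; apply: esym; apply: H.
exact: cvg_comp (@cvg_addnl 1) cIm.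
Qed.

Lemma Kinf_entry_le s t : Xfin s -> Xfin t ->
  `|complex.Re (Kinf s t)| <= (ufin s + ufin t) / 2 /\
  `|complex.Im (Kinf s t)| <= (ufin s + ufin t) / 2.
Proof.
move=> sfin tfin; have [cRe cIm] := cvg_Kn sfin tfin.
have uM n : (un n s + un n t) / 2 <= (ufin s + ufin t) / 2.
  by rewrite ler_wpM2r// lerD// un_le_ufin.
have [H1 H2] : (forall n, `|complex.Re (Kn n s t)| <= (ufin s + ufin t) / 2) /\
               (forall n, `|complex.Im (Kn n s t)| <= (ufin s + ufin t) / 2).
  by split=> n; have [H1 H2] := pd_entry_le s t (Kn_pd n); apply: le_trans (uM n).
split; [apply: (cvgr_to_le (cvg_norm cRe))|apply: (cvgr_to_le (cvg_norm cIm))];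
  exact: nearW.
Qed.

End KernelIteration.

(** * The square norm of complex random variables *)

Section ComplexL2.
Context d (T : measurableType d) (R : realType) (P : probability T R).
Implicit Types f : T -> R[i].

Lemma Lnorm2_normc f : cmeasurable f ->
  Lnorm P 2%:E (fun x => (ComplexField.Normc.normc (f x))%:E) =
  ((\int[P]_x (complex.Re (f x) ^+ 2)%:E +
    \int[P]_x (complex.Im (f x) ^+ 2)%:E) `^ 2^-1)%E.
Proof.
move=> [mRe mIm]; rewrite unlock /Lnorm; congr (_ `^ _)%E.
have m2 (g : T -> R) : measurable_fun setT g ->
    measurable_fun setT (fun x => (g x ^+ 2)%:E).
  by move=> mg; apply/measurable_EFinP; exact: measurable_funX.
rewrite -ge0_integralD//; [|by move=> x _; rewrite lee_fin sqr_ge0|exact: m2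
  |by move=> x _; rewrite lee_fin sqr_ge0|exact: m2].
apply: eq_integral => x _; rewrite abse_EFin poweR_EFin powR_mulrn ?normr_ge0//.
case: (f x) => a b /=.
by rewrite ger0_norm ?sqrtr_ge0// sqr_sqrtr// addr_ge0 ?sqr_ge0.
Qed.

(** Turns convergence of the integrals of squares into convergence of the
    norms. *)
Lemma cvg_poweR_half (a : nat -> \bar R) :
  a @ \oo --> 0%E -> (forall n, 0 <= a n)%E ->
  (fun n => a n `^ 2^-1)%E @ \oo --> 0%E.
Proof.
move=> /fine_cvgP[afin a0] age0.
apply: (@cvg_trans _ ((fun n => (Num.sqrt (fine (a n)))%:E) @ \oo)).
  apply: near_eq_cvg; apply: filterS afin => n an.
  rewrite -[in RHS](fineK an) poweR_EFin powR12_sqrt//.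
  exact: fine_ge0.
apply: cvg_EFin; first exact: nearW.
rewrite -[X in _ --> X]sqrtr0.
apply: continuous_cvg => //; exact: sqrt_continuous.
Qed.
End ComplexL2.

(** * The kernel martingale *)

Section KernelWords.
Context {R : realType} {X : Type} {p : nat} (phi : 'I_p.+1 -> X -> X).
Variable K : ckernel R X.
Hypotheses (K_pd : positive_definite K) (K_le : kernel_le K (pullback phi K)).
Local Notation ufin := (ufin phi K).
Local Notation Xfin := (Xfin phi K).
Local Notation X2 := (X2 phi K).

(** With [h] the real or the imaginary part of [K_infty], this is the real or
    imaginary part of [M_n] as a function of the word. *)
Definition word_weight (h : X -> X -> R) s t (v : seq 'I_p.+1) : R :=
  p.+1%:R ^+ size v * h (word_map phi v s) (word_map phi v t).

(** The invariance of [h] and the factor [m] that each letter adds to the weight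
    compensate the factor [1 / m] of the mean over a letter. *)
Lemma word_weight_martingale h s t :
  (forall a b, Xfin a -> Xfin b -> h a b = \sum_(i < p.+1) h (phi i a) (phi i b)) ->
  Xfin s -> Xfin t -> word_martingale (word_weight h s t).
Proof.
move=> hS sfin tfin w; rewrite word_meanS {1}/word_weight.
rewrite hS; [|exact: Xfin_word|exact: Xfin_word].
rewrite mulr_sumr [in RHS]mulr_sumr; apply: eq_bigr => i _.
rewrite word_mean0 /word_weight size_rcons exprS /word_map !foldl_rcons.
by rewrite !mulrA mulVf ?mul1r// pnatr_eq0.
Qed.

Lemma X2_bound s : X2 s -> exists C : R, forall n,
  p.+1%:R ^+ n * \sum_(w : n.-tuple 'I_p.+1) ufin (word_map phi w s) ^+ 2 <= C.
Proof.
move=> [sfin Bs]; exists (fine (Bsup phi K s)) => n.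
have le_B : ((p.+1%:R ^+ n)%:E *
    \sum_(w : n.-tuple 'I_p.+1) uinf phi K (word_map phi w s) ^+ 2 <=
    Bsup phi K s)%E by apply: ereal_sup_ubound; exists n.
have E : ((p.+1%:R ^+ n)%:E *
    \sum_(w : n.-tuple 'I_p.+1) uinf phi K (word_map phi w s) ^+ 2 =
    (p.+1%:R ^+ n * \sum_(w : n.-tuple 'I_p.+1) ufin (word_map phi w s) ^+ 2)%:E)%E.
  rewrite EFinM -sumEFin; congr (_ * _)%E; apply: eq_bigr => w _.
  by rewrite uinfE//; exact: Xfin_word.
rewrite -lee_fin fineK -?E// fin_real// Bs andbT.
by apply: lt_le_trans le_B; rewrite E ltNyr.
Qed.

(** The weight [m ^ 2n] of the square against the probability [m ^ -n] of a word
    leaves the factor [m ^ n] that appears in [Bsup], and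
    [((a + b) / 2) ^+ 2 <= (a ^+ 2 + b ^+ 2) / 2] separates [s] from [t]. *)
Lemma word_weight_bound h s t :
  (forall a b, Xfin a -> Xfin b -> `|h a b| <= (ufin a + ufin b) / 2) ->
  X2 s -> X2 t -> exists C, forall n, moment2 (word_weight h s t) n <= C.
Proof.
move=> hb s2 t2; have [Cs Hs] := X2_bound s2; have [Ct Ht] := X2_bound t2.
have [sfin _] := s2; have [tfin _] := t2.
exists ((Cs + Ct) / 2) => n; apply: (@le_trans _ _ (p.+1%:R ^+ n *
   \sum_(w : n.-tuple 'I_p.+1)
     (ufin (word_map phi w s) ^+ 2 / 2 + ufin (word_map phi w t) ^+ 2 / 2)));
  last first.
  by rewrite big_split/= -!mulr_suml mulrDr !mulrA -mulrDl ler_wpM2r// lerD.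
rewrite /moment2 /word_mean !mulr_sumr; apply: ler_sum => w _.
rewrite cat0s /word_weight size_tuple.
have m0 : p.+1%:R ^+ n != 0 :> R by rewrite expf_neq0// pnatr_eq0.
have mulVsqr M (a : R) : M != 0 -> M^-1 * (M * a) ^+ 2 = M * a ^+ 2.
  by move=> M0; field.
rewrite mulVsqr// ler_wpM2l ?exprn_ge0//.
have := hb _ _ (Xfin_word K_pd K_le w sfin) (Xfin_word K_pd K_le w tfin).
move: (h _ _) (ufin _) (ufin _) => a b c; rewrite ler_norml => /andP[H1 H2].
have : 0 <= ((b + c) / 2 - a) * ((b + c) / 2 + a) by apply: mulr_ge0; lra.
have := sqr_ge0 (b - c); rewrite !expr2; lra.
Qed.

End KernelWords.

Theorem theorem5p6 (R : realType) (X : Type) (p : nat)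
    (phi : 'I_p.+1 -> X -> X) (K : ckernel R X)
    (K_pd : positive_definite K)
    (K_le : kernel_le K (pullback phi K))
    (mu : probability (Omega p) R) (mu_prod : uniform_product_measure mu)
    (s t : X) (s_X2 : X2 phi K s) (t_X2 : X2 phi K t) :
  exists Minf : Omega p -> R[i],
    [/\ cvg_cL2 mu (Mn phi K s t) Minf,
        cvg_ae mu (Mn phi K s t) Minf &
        Kinf phi K s t = cexpectation mu Minf].
Proof.
have [sfin _] := s_X2; have [tfin _] := t_X2.
pose FRe := word_weight phi (fun a b => complex.Re (Kinf phi K a b)) s t.
pose FIm := word_weight phi (fun a b => complex.Im (Kinf phi K a b)) s t.
have FRe_mart : word_martingale FRe.
  apply: (@word_weight_martingale _ _ _ _ K) => // a b afin bfin.
  by rewrite (Kinf_invariant K_pd K_le)// raddf_sum.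
have FIm_mart : word_martingale FIm.
  apply: (@word_weight_martingale _ _ _ _ K) => // a b afin bfin.
  by rewrite (Kinf_invariant K_pd K_le)// raddf_sum.
have [CRe FRe_bound] : exists C, forall n, moment2 FRe n <= C.
  by apply: (@word_weight_bound _ _ _ _ K) => // a b afin bfin;
    have [] := Kinf_entry_le K_pd K_le afin bfin.
have [CIm FIm_bound] : exists C, forall n, moment2 FIm n <= C.
  by apply: (@word_weight_bound _ _ _ _ K) => // a b afin bfin;
    have [] := Kinf_entry_le K_pd K_le afin bfin.
have [YRe [mYRe YRe2 XRe0 aeRe ERe]] :=
  word_martingale_L2_convergence mu_prod FRe_mart FRe_bound.
have [YIm [mYIm YIm2 XIm0 aeIm EIm]] :=
  word_martingale_L2_convergence mu_prod FIm_mart FIm_bound.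
have MnE n w : Mn phi K s t n w = Complex (FRe (word_upto n w)) (FIm (word_upto n w)).
  rewrite /Mn /FRe /FIm /word_weight size_tuple.
  have -> : p.+1%:R ^+ n = Complex (p.+1%:R ^+ n) 0 :> R[i].
    by rewrite -[RHS]/(real_complex R _) rmorphXn rmorph_nat.
  case: (Kinf _ _ _ _) => a b /=; apply/eqP.
  by rewrite eq_complex /= !mul0r subr0 addr0 !eqxx.
have ReMn n : (fun w => complex.Re (Mn phi K s t n w)) = (fun w => FRe (word_upto n w)).
  by apply/funext => w; rewrite MnE.
have ImMn n : (fun w => complex.Im (Mn phi K s t n w)) = (fun w => FIm (word_upto n w)).
  by apply/funext => w; rewrite MnE.
have mMn n : cmeasurable (Mn phi K s t n).
  by split; rewrite ?ReMn ?ImMn; exact: measurable_word_fun.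
pose Minf w := Complex (YRe w) (YIm w).
have mMinf : cmeasurable Minf by [].
exists Minf; split.
- split.
  + move=> n; split; first exact: mMn.
    rewrite /finite_norm /comp Lnorm2_normc//; apply: poweR_lty.
    under eq_integral do rewrite MnE.
    under [X in (_ + X)%E]eq_integral do rewrite MnE.
    rewrite /= (integral_word_fun n (fun v => FRe v ^+ 2) mu_prod).
    by rewrite (integral_word_fun n (fun v => FIm v ^+ 2) mu_prod) -EFinD ltry.
  + split=> //; rewrite /finite_norm /comp Lnorm2_normc//; apply: poweR_lty.
    by rewrite lte_add_pinfty.
  + pose a n := (\int[mu]_w ((FRe (word_upto n w) - YRe w) ^+ 2)%:E +
               \int[mu]_w ((FIm (word_upto n w) - YIm w) ^+ 2)%:E)%E.
    have a0 : a @ \oo --> 0%E by rewrite -[0%E]adde0; apply: cvgeD.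
    have age0 n : (0 <= a n)%E.
      by apply: adde_ge0; apply: integral_ge0 => w _; rewrite lee_fin sqr_ge0.
    have LE n : Lnorm mu 2%:E (fun w =>
        (ComplexField.Normc.normc (Mn phi K s t n w - Minf w))%:E) =
        (a n `^ 2^-1)%E.
      rewrite Lnorm2_normc.
        by congr (poweR (_ + _)%E _); apply: eq_integral => w _; rewrite MnE.
      split; under [X in measurable_fun _ X]funext do rewrite MnE;
        by apply: measurable_funB => //; exact: measurable_word_fun.
    by rewrite (funext LE); exact: cvg_poweR_half.
- apply: filterS2 aeRe aeIm => w cRe cIm.
  apply: cvg_complex.
    by under eq_fun do rewrite MnE.
  by under eq_fun do rewrite MnE.
- rewrite /cexpectation unlock ERe EIm /= /FRe /FIm /word_weight !mul1r.
  by case: (Kinf _ _ _ _).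
Qed.
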